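(* (i) There are infinitely many $C_4$-divisible graphs $G$ with $\delta(G)\geq 2|G|/3-2$ and no $C_4$-decomposition. (ii) Let $k\in\mathbb{N}$, $k\geq 2$. There are infinitely many $C_{2k}$-divisible graphs $G$ with $\delta(G)\geq |G|/2-1$ and no $C_{2k}$-decomposition.
   Context: Graphs are finite and simple; $|G|$ is the number of vertices, $e(G)$ the number of edges and $\delta(G)$ the minimum degree of $G$. $C_\ell$ denotes the cycle of length $\ell$. A graph $G$ is $C_\ell$-divisible if $e(G)$ is divisible by $\ell$ and every vertex of $G$ has even degree. A graph $G$ has a $C_\ell$-decomposition if its edge set can be partitioned into copies of $C_\ell$. *)

(* Defs.v *)
From HB Require Import structures.
From mathcomp Require Import all_boot all_order all_algebra.

Set Implicit Arguments.
Unset Strict Implicit.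
Unset Printing Implicit Defensive.

Record sgraph := SGraph {
  vertex :> finType;
  adj : rel vertex;
  adj_sym : symmetric adj;
  adj_irr : irreflexive adj
}.

Definition edges (G : sgraph) : {set {set G}} :=
  [set [set p.1; p.2] | p : G * G & adj p.1 p.2].

Definition num_edges (G : sgraph) : nat := #|edges G|.

Definition degree (G : sgraph) (v : G) : nat := #|[set w | adj v w]|.

(* Every degree is less than #|G|, so the default value only matters for the
   graph with no vertices, whose minimum degree is 0 by convention. *)
Definition min_degree (G : sgraph) : nat :=
  \big[minn/#|G|]_(v : G) degree v.

Definition isomorphic (G H : sgraph) : Prop :=
  exists f : G -> H, bijective f /\ {mono f : x y / adj x y}.

(* Infinitely many graphs up to isomorphism. *)
Definition infinitely_many (P : sgraph -> Prop) : Prop :=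
  exists F : nat -> sgraph,
    (forall n, P (F n)) /\ (forall m n, isomorphic (F m) (F n) -> m = n).

(* ordS is the successor modulo l. This is the l-cycle only when 3 <= l. *)
Definition cycle_adj (l : nat) : rel 'I_l :=
  fun i j => (i != j) && ((ordS i == j) || (ordS j == i)).

Lemma cycle_adj_sym (l : nat) : symmetric (@cycle_adj l).
Proof. by move=> i j; rewrite /cycle_adj eq_sym orbC. Qed.

Lemma cycle_adj_irr (l : nat) : irreflexive (@cycle_adj l).
Proof. by move=> i; rewrite /cycle_adj eqxx. Qed.

Definition cycle_graph (l : nat) : sgraph :=
  SGraph (@cycle_adj_sym l) (@cycle_adj_irr l).

(* E is the edge set of a copy of H on vertices of G. That E consists of edges
   of G is not required here: in a decomposition it follows from [partition]. *)
Definition copy_edges (H G : sgraph) (E : {set {set G}}) : Prop :=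
  exists f : H -> G, injective f /\ E = [set f @: e | e : {set H} in edges H].

Definition has_decomposition (H G : sgraph) : Prop :=
  exists D : {set {set {set G}}},
    partition D (edges G) /\ (forall E, E \in D -> copy_edges H E).

Definition cycle_divisible (l : nat) (G : sgraph) : Prop :=
  l %| num_edges G /\ (forall v : G, ~~ odd (degree v)).

(* Main.v *)
(* In both parts a vertex set A is chosen so that every l-cycle of G has a
   multiple of d edges inside A, while d does not divide the number of edges
   inside A; summing over the cycles of a decomposition is then impossible.
   For (i), G consists of two cliques of orders 4t+2 and 4t+6, both completely
   joined to an independent set of order 4t+7, A is the smaller clique and
   d = 2: every 4-cycle has an even number of edges inside A, but the number of
   edges inside A is (2t+1)(4t+1). For (ii), G is the disjoint union of two
   cliques of order m = 2k(2t+1)+1, A is one of them and d = l = 2k: a cycle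
   stays in one clique, and A spans k(2t+1)m edges, an odd multiple of k, while
   G has twice as many. *)
Require Import Defs.
From mathcomp Require Import all_boot all_order all_algebra.
From mathcomp Require Import zify lra.

Set Implicit Arguments.
Unset Strict Implicit.
Unset Printing Implicit Defensive.

(** * Edges inside a vertex set, and degrees *)

Definition edges_within (G : sgraph) (A : {set G}) : {set {set G}} :=
  [set e in edges G | e \subset A].

Lemma edges_withinT (G : sgraph) : edges_within [set: G] = edges G.
Proof. by apply/setP=> e; rewrite !inE subsetT andbT. Qed.

Lemma set2_eq (T : finType) (a b c d : T) :
  [set a; b] = [set c; d] -> (a = c /\ b = d) \/ (a = d /\ b = c).
Proof.
move=> E.
have: a \in [set c; d] by rewrite -E set21.
have: b \in [set c; d] by rewrite -E set22.
have: c \in [set a; b] by rewrite E set21.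
have: d \in [set a; b] by rewrite E set22.
rewrite !inE => /orP[]/eqP-> /orP[]/eqP-> /orP[]/eqP hb /orP[]/eqP ha.
all: by subst; auto.
Qed.

Lemma edgesP (G : sgraph) (x y : G) : ([set x; y] \in edges G) = adj x y.
Proof.
apply/imsetP/idP => [[[a b]]|xy]; last by exists (x, y); rewrite ?inE.
rewrite inE /= => ab /set2_eq[[-> ->] // | [-> ->]].
by rewrite adj_sym.
Qed.

(** Double counting of ordered adjacent pairs in [A]: by first vertex they give the sum, by
    underlying edge they give each edge twice. *)
Lemma double_card_edges_within (G : sgraph) (A : {set G}) :
  #|edges_within A| * 2 = \sum_(v in A) #|[set w in A | adj v w]|.
Proof.
transitivity (\sum_(p : G * G | [&& p.1 \in A, p.2 \in A & adj p.1 p.2]) 1);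
  last first.
  rewrite -(pair_big_dep (mem A) (fun v w => (w \in A) && adj v w) (fun _ _ => 1)).
  by apply: eq_bigr => v _; rewrite sum1dep_card.
rewrite (partition_big (fun p : G * G => [set p.1; p.2]) (mem (edges_within A))) /=.
  rewrite -sum_nat_const; apply: eq_bigr => e.
  rewrite inE => /andP[/imsetP[[x y]]]; rewrite inE /= => xy -> sA.
  have xney : x != y by apply: contraTneq xy => ->; rewrite adj_irr.
  have xA : x \in A by apply: (subsetP sA); rewrite set21.
  have yA : y \in A by apply: (subsetP sA); rewrite set22.
  rewrite sum1dep_card.
  transitivity #|[set (x, y); (y, x)]|.
    by rewrite cards2 xpair_eqE (negPf xney).
  apply: eq_card => -[a b]; rewrite !inE !xpair_eqE /=.
  apply/idP/idP.
    by case/orP=> /andP[/eqP-> /eqP->]; rewrite xA yA /= ?xy ?eqxx //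
       adj_sym xy setUC eqxx.
  case/andP=> _ /eqP/set2_eq[[-> ->]|[-> ->]]; by rewrite !eqxx ?orbT.
case=> a b /= /and3P[aA bA ab].
by rewrite inE edgesP ab subUset !sub1set aA bA.
Qed.

Lemma sum_degree (G : sgraph) : num_edges G * 2 = \sum_(v : G) degree v.
Proof.
rewrite /num_edges -edges_withinT double_card_edges_within.
apply: eq_big => [v|v _]; first by rewrite inE.
by apply: eq_card => w; rewrite !inE.
Qed.

(** The bound [d <= #|G|] handles the default value of the minimum. *)
Lemma leq_min_degree (G : sgraph) (d : nat) :
  d <= #|G| -> (forall v : G, d <= degree v) -> d <= min_degree G.
Proof.
move=> dG dv; apply: (big_ind (fun x => d <= x)) => // x y.
by rewrite leq_min => -> ->.
Qed.

Lemma isomorphic_card (G H : sgraph) : isomorphic G H -> #|G| = #|H|.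
Proof. by case=> f [/bij_eq_card]. Qed.

(** * Cycles and the divisibility obstruction *)

Lemma neq_ordS l (i : 'I_l) : 2 <= l -> i != ordS i.
Proof.
move=> l2; apply/eqP => /(congr1 val) /=; have := ltn_ord i.
case: (ltngtP i.+1 l) => [il|//|il] _; first by rewrite modn_small //; lia.
by rewrite il modnn; lia.
Qed.

Lemma neq_ordS2 l (i : 'I_l) : 3 <= l -> i != ordS (ordS i).
Proof.
move=> l3; apply/eqP => /(congr1 val) /=; have := ltn_ord i.
case: (ltngtP i.+1 l) => [il|//|il] _; last first.
  by rewrite il modnn modn_small; lia.
rewrite (modn_small il); case: (ltngtP i.+2 l) => [il2|//|il2].
- by rewrite modn_small //; lia.
- by lia.
- by rewrite il2 modnn; lia.
Qed.

Lemma edges_cycle_graph l :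
  2 <= l -> edges (cycle_graph l) = [set [set i; ordS i] | i : 'I_l].
Proof.
move=> l2; apply/setP => e; apply/imsetP/imsetP.
  case=> -[i j]; rewrite inE /= => /andP[_ /orP[]/eqP <- ->].
    by exists i.
  by exists j => //; rewrite setUC.
case=> i _ ->; exists (i, ordS i) => //.
by rewrite inE /= /cycle_adj neq_ordS // eqxx.
Qed.

Lemma copy_edges_cycleP (l : nat) (G : sgraph) (E : {set {set G}}) : 3 <= l ->
  copy_edges (cycle_graph l) E ->
  exists2 f : 'I_l -> G, injective f & E = [set [set f i; f (ordS i)] | i : 'I_l].
Proof.
move=> l3 [f [fI ->]]; exists f => //.
rewrite edges_cycle_graph ?(ltnW l3) // -imset_comp.
by apply: eq_imset => i /=; rewrite imsetU1 imset_set1.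
Qed.

(** Edges can be counted by index: two indices giving the same edge would force [ordS (ordS i) = i],
    impossible for [3 <= l]. *)
Lemma card_cycle_within (l : nat) (G : sgraph) (A : {set G}) (f : 'I_l -> G) :
  3 <= l -> injective f ->
  #|[set e in [set [set f i; f (ordS i)] | i : 'I_l] | e \subset A]|
    = #|[set i | (f i \in A) && (f (ordS i) \in A)]|.
Proof.
move=> l3 fI.
have gI : injective (fun i => [set f i; f (ordS i)]).
  move=> i j /set2_eq[[/fI //]|[/fI ij /fI ji]].
  by have := neq_ordS2 i l3; rewrite ji -ij eqxx.
rewrite -(card_imset _ gI); apply: eq_card => e; rewrite !inE.
apply/andP/imsetP => [[/imsetP[i _ ->] sA]|[i iA ->]].
  by exists i => //; rewrite inE -!sub1set -subUset.
split; first by apply/imsetP; exists i.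
by rewrite subUset !sub1set; move: iA; rewrite inE.
Qed.

(** A decomposition splits the edges inside [A] cycle by cycle, and each share is a multiple of
    [d]. *)
Lemma cycle_decomposition_dvdn (l d : nat) (G : sgraph) (A : {set G}) : 3 <= l ->
  (forall f : 'I_l -> G, (forall i, adj (f i) (f (ordS i))) ->
     d %| #|[set i | (f i \in A) && (f (ordS i) \in A)]|) ->
  has_decomposition (cycle_graph l) G -> d %| #|edges_within A|.
Proof.
move=> l3 dA [D [Dpart Dcopy]].
rewrite /edges_within -sum1dep_card.
rewrite (set_partition_big_cond _ Dpart) /=; apply: dvdn_sum => E ED.
rewrite sum1dep_card; have [f fI defE] := copy_edges_cycleP l3 (Dcopy _ ED).
rewrite defE card_cycle_within //; apply: dA => i.
rewrite -edgesP -(cover_partition Dpart); apply/bigcupP; exists E => //.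
by rewrite defE; apply/imsetP; exists i.
Qed.

(** * Graphs made of cliques and independent sets *)

Section Blowup.
Variables (r : nat) (s : 'I_r.+1 -> nat).

Definition blowup_vertex : finType := {i : 'I_r.+1 & 'I_(s i)}.

(* Distinct vertices of parts i and j are joined unless i + j = r: for r = 1
   this is two disjoint cliques, for r = 2 two cliques (parts 0 and 2) both
   completely joined to an independent set (part 1). *)
Definition blowup_adj : rel blowup_vertex :=
  fun x y => (x != y) && (tag x + tag y != r).

Lemma blowup_adj_sym : symmetric blowup_adj.
Proof. by move=> x y; rewrite /blowup_adj eq_sym addnC. Qed.

Lemma blowup_adj_irr : irreflexive blowup_adj.
Proof. by move=> x; rewrite /blowup_adj eqxx. Qed.

Definition blowup : sgraph := SGraph blowup_adj_sym blowup_adj_irr.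

Definition part (i : 'I_r.+1) : {set blowup} := [set x | tag x == i].

Lemma sum_blowup (P : pred 'I_r.+1) (F : 'I_r.+1 -> nat) :
  \sum_(x : blowup | P (tag x)) F (tag x) = \sum_(i | P i) s i * F i.
Proof.
transitivity (\sum_(i | P i) \sum_(j : 'I_(s i)) F i).
  rewrite (sig_big_dep _ (fun _ _ => true)) /=.
  by apply: eq_bigl => x; rewrite andbT.
by apply: eq_bigr => i _; rewrite sum_nat_const card_ord.
Qed.

Lemma card_blowup_pred (P : pred 'I_r.+1) :
  #|[set x : blowup | P (tag x)]| = \sum_(i | P i) s i.
Proof.
rewrite -sum1dep_card (sum_blowup P (fun=> 1)).
by apply: eq_bigr => i _; rewrite muln1.
Qed.

Lemma card_blowup : #|blowup| = \sum_i s i.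
Proof. by rewrite -(card_blowup_pred xpredT); apply: eq_card => x; rewrite inE. Qed.

(** The subtracted boolean discounts [x] itself when its part is a clique. *)
Lemma degree_blowup (x : blowup) :
  degree x = \sum_(j : 'I_r.+1 | tag x + j != r) s j - (tag x + tag x != r).
Proof.
rewrite -card_blowup_pred (cardsD1 x) inE addKn.
by apply: eq_card => y; rewrite !inE /= /blowup_adj eq_sym.
Qed.

Lemma num_edges_blowup : num_edges blowup * 2
  = \sum_i s i * (\sum_(j : 'I_r.+1 | i + j != r) s j - (i + i != r)).
Proof.
rewrite sum_degree -(sum_blowup xpredT); apply: eq_bigr => x _.
exact: degree_blowup.
Qed.

Lemma card_edges_within_part (i : 'I_r.+1) : i + i != r ->
  #|edges_within (part i)| * 2 = s i * (s i).-1.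
Proof.
move=> iir; rewrite double_card_edges_within.
have card_part : #|part i| = s i.
  by rewrite (card_blowup_pred (pred1 i)) big_pred1_eq.
rewrite -card_part -sum_nat_const; apply: eq_bigr => x xi.
rewrite (cardsD1 x (part i)) xi /=; apply: eq_card => y.
move: xi; rewrite !inE /= /blowup_adj => /eqP->.
by rewrite (eq_sym y x); case: (tag y =P i) => [->|_]; rewrite ?andbF // iir !andbT.
Qed.

End Blowup.

(** * Two cliques joined to an independent set *)

Definition tripartite_size (t : nat) (i : 'I_3) : nat :=
  nth 0 [:: 4 * t + 2; 4 * t + 7; 4 * t + 6] i.

Definition tripartite (t : nat) : sgraph := blowup (tripartite_size t).

Lemma card_tripartite t : #|tripartite t| = 12 * t + 15.
Proof.
rewrite card_blowup !big_ord_recl big_ord0 /tripartite_size /=; lia.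
Qed.

(** The part sizes make every degree even and the least one, [8 * t + 8], equal to 2(12t + 15)/3 -
    2. *)
Lemma degree_tripartite t (x : tripartite t) :
  degree x = nth 0 [:: 8 * t + 8; 8 * t + 8; 8 * t + 12] (tag x).
Proof.
rewrite degree_blowup; case: x => -[[|[|[|i]]] ilt] y //=;
rewrite big_mkcond !big_ord_recl big_ord0 /tripartite_size /=; lia.
Qed.

Lemma num_edges_tripartite t :
  num_edges (tripartite t) = 4 * (12 * t ^ 2 + 29 * t + 18).
Proof.
have := num_edges_blowup (tripartite_size t).
rewrite !big_ord_recl big_ord0.
do 3! rewrite big_mkcond !big_ord_recl big_ord0.
rewrite /tripartite_size /= -/(tripartite t); nia.
Qed.

(* A 4-cycle with an odd number of edges inside part 0 would have exactly one,
   and its other two vertices would be adjacent vertices of the independent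
   part 1. *)
Lemma C4_part_even t (f : 'I_4 -> tripartite t) :
  (forall i, adj (f i) (f (ordS i))) ->
  2 %| #|[set i | (f i \in part _ ord0) && (f (ordS i) \in part _ ord0)]|.
Proof.
move=> fadj.
have tadj i : tag (f i) + tag (f (ordS i)) != 2 by have /andP[] := fadj i.
rewrite -sum1dep_card big_mkcond /= !big_ord_recl big_ord0 !inE.
have := tadj ord0; have := tadj (lift ord0 ord0).
have := tadj (lift ord0 (lift ord0 ord0)).
have := tadj (lift ord0 (lift ord0 (lift ord0 ord0))).
have -> : ordS (ord0 : 'I_4) = lift ord0 ord0 by apply: val_inj.
have -> : ordS (lift ord0 ord0 : 'I_4) = lift ord0 (lift ord0 ord0) by apply: val_inj.
have -> : ordS (lift ord0 (lift ord0 ord0) : 'I_4)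
  = lift ord0 (lift ord0 (lift ord0 ord0)) by apply: val_inj.
have -> : ordS (lift ord0 (lift ord0 (lift ord0 ord0)) : 'I_4) = ord0
  by apply: val_inj.
rewrite -!val_eqE /=.
(* Only the parts of the four vertices matter now, which leaves a finite check. *)
move: (tag (f _)) (tag (f _)) (tag (f _)) (tag (f _)).
by do 4! [case=> -[|[|[|?]]] ? //=].
Qed.

Lemma tripartite_no_C4_decomposition t :
  ~ has_decomposition (cycle_graph 4) (tripartite t).
Proof.
move/(cycle_decomposition_dvdn (isT : 3 <= 4) (@C4_part_even t)).
have := @card_edges_within_part _ (tripartite_size t) ord0 isT.
(* This gives [4 * q = (4 * t + 2) * (4 * t + 1)], impossible modulo 4. *)
rewrite /tripartite_size /= => h /dvdnP[q hq]; move: h; rewrite hq; nia.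
Qed.

(** * Two disjoint cliques *)

Definition two_cliques (m : nat) : sgraph := blowup (fun _ : 'I_2 => m).

Lemma card_two_cliques m : #|two_cliques m| = 2 * m.
Proof. by rewrite card_blowup sum_nat_const card_ord. Qed.

Lemma degree_two_cliques m (x : two_cliques m) : degree x = m.-1.
Proof.
rewrite degree_blowup; case: x => -[[|[|i]] ilt] y //=;
rewrite big_mkcond !big_ord_recl big_ord0 /=; lia.
Qed.

Lemma num_edges_two_cliques m : num_edges (two_cliques m) = m * m.-1.
Proof.
have := sum_degree (two_cliques m).
under eq_bigr => x _ do rewrite degree_two_cliques.
rewrite sum_nat_const card_two_cliques; nia.
Qed.

(** Adjacent vertices have tags in {0, 1} whose sum is not 1, hence equal tags; induction on the
    index does the rest. *)
Lemma cycle_in_clique m l (f : 'I_l -> two_cliques m) :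
  (forall i, adj (f i) (f (ordS i))) -> forall i j, tag (f i) = tag (f j).
Proof.
move=> fadj.
have tagS i : tag (f (ordS i)) = tag (f i).
  have /andP[_] := fadj i; move: (tag (f i)) (tag (f (ordS i))).
  by case=> -[|[|?]] ? // [] [|[|?]] ? //= _; apply: val_inj.
case: l f fadj tagS => [f _ _ []//|l f _ tagS].
suff tag0 i : tag (f i) = tag (f ord0) by move=> i j; rewrite !tag0.
case: i => n; elim: n => [|n IH] nl; first by congr (tag (f _)); apply: val_inj.
rewrite -(IH (ltnW nl)) -[RHS]tagS; congr (tag (f _)); apply: val_inj.
by rewrite /= modn_small.
Qed.

Lemma two_cliques_no_decomposition m l : 3 <= l -> ~~ (l * 2 %| m * m.-1) ->
  ~ has_decomposition (cycle_graph l) (two_cliques m).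
Proof.
move=> l3 /negP ndvd dec; apply: ndvd.
rewrite -(@card_edges_within_part _ (fun _ : 'I_2 => m) ord0 isT).
rewrite dvdn_pmul2r //; apply: cycle_decomposition_dvdn dec => // f fadj.
have tagE := cycle_in_clique fadj.
case: l l3 f fadj tagE => // l _ f _ tagE.
(* The clique containing [f ord0] decides whether all [l] edges count or none. *)
case: (boolP (f ord0 \in part (fun _ : 'I_2 => m) ord0)); rewrite inE => f0.
  rewrite (_ : [set _ | _] = setT) ?cardsT ?card_ord //.
  by apply/setP => i; rewrite !inE (tagE i ord0) (tagE (ordS i) ord0) f0.
rewrite (_ : [set _ | _] = set0) ?cards0 //.
by apply/setP => i; rewrite !inE (tagE i ord0) (negPf f0).
Qed.

(** With this order m, all degrees are m - 1 = |G|/2 - 1, an odd multiple of 2k. *)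
Definition clique_size (k t : nat) : nat := 2 * k * (2 * t + 1) + 1.

(** * Both families meet the requirements *)

Theorem proposition1p4 :
  infinitely_many (fun G : sgraph =>
    [/\ cycle_divisible 4 G,
        (2 * #|G|%:R / 3 - 2 <= (min_degree G)%:R :> rat)%R
      & ~ has_decomposition (cycle_graph 4) G]) /\
  (forall k : nat, 2 <= k ->
    infinitely_many (fun G : sgraph =>
      [/\ cycle_divisible (2 * k) G,
          (#|G|%:R / 2 - 1 <= (min_degree G)%:R :> rat)%R
        & ~ has_decomposition (cycle_graph (2 * k)) G])).
Proof.
split=> [|k k2].
  (* Different [t] give different orders, hence non-isomorphic graphs. *)
  exists tripartite; split=> [t|t u /isomorphic_card]; last first.
    by rewrite !card_tripartite; lia.
  split; last exact: tripartite_no_C4_decomposition.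
    split=> [|x]; first by rewrite num_edges_tripartite dvdn_mulr.
    by rewrite degree_tripartite; case: (tag x) => -[|[|[|?]]] ? //=; lia.
  have : 8 * t + 8 <= min_degree (tripartite t).
    apply: leq_min_degree => [|x]; first by rewrite card_tripartite; lia.
    by rewrite degree_tripartite; case: (tag x) => -[|[|[|?]]] ? //=; lia.
  rewrite card_tripartite -(Num.Theory.ler_nat rat); lra.
exists (fun t => two_cliques (clique_size k t)).
split=> [t|t u /isomorphic_card]; last first.
  rewrite !card_two_cliques /clique_size => /eqP.
  rewrite eqn_pmul2l // eqn_add2r eqn_pmul2l ?eqn_add2r ?eqn_pmul2l;
    by [move/eqP | lia].
have predm : (clique_size k t).-1 = 2 * k * (2 * t + 1).
  by rewrite /clique_size addn1.
split.
- split=> [|x]; first by rewrite num_edges_two_cliques predm mulnCA dvdn_mulr.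
  by rewrite degree_two_cliques predm !oddM.
- have : (clique_size k t).-1 <= min_degree (two_cliques (clique_size k t)).
    apply: leq_min_degree => [|x]; last by rewrite degree_two_cliques.
    by rewrite card_two_cliques; lia.
  rewrite predm card_two_cliques /clique_size -(Num.Theory.ler_nat rat).
  rewrite !(GRing.natrD, GRing.natrM); lra.
- apply: two_cliques_no_decomposition; first by lia.
  (* Cancelling [2 * k] leaves the product of the odd numbers m and [2 * t + 1], to be shown odd. *)
  rewrite predm mulnCA dvdn_pmul2l; last by lia.
  by rewrite dvdn2 negbK oddM /clique_size !oddD !oddM /=; case: (odd t).
Qed.
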